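(* For every integer $k\ge 5$, there exists a graph $G$ on $k^2-4$ vertices such that every vertex of $G$ has degree at most $3$, and $r_+(G)\ge r_+(H_k'')$.
   Context: All graphs are finite, simple, undirected. $\mathrm{STAB}(G)$ is the convex hull of incidence vectors of stable sets of $G$; $\mathrm{FRAC}(G)=\{x\in[0,1]^{V(G)}: x_i+x_j\le 1\ \forall\{i,j\}\in E(G)\}$. For $P\subseteq[0,1]^n$, $\mathrm{cone}(P)=\{(\lambda,\lambda x):\lambda\ge0,x\in P\}\subseteq\mathbb{R}^{n+1}$ (coordinates $0,\dots,n$); $\widehat{\mathrm{LS}}_+(P)$ is the set of symmetric PSD $(n+1)\times(n+1)$ matrices $Y$ with $Ye_0=\mathrm{diag}(Y)$ and $Ye_i,Y(e_0-e_i)\in\mathrm{cone}(P)$ for all $i\in[n]$; $\mathrm{LS}_+(P)=\{x:\exists Y\in\widehat{\mathrm{LS}}_+(P), Ye_0=(1,x)\}$; $\mathrm{LS}_+^k$ is the $k$-fold iterate ($\mathrm{LS}_+^0(P)=P$), $\mathrm{LS}_+^k(G)=\mathrm{LS}_+^k(\mathrm{FRAC}(G))$, and $r_+(G)$ (the $\mathrm{LS}_+$-rank) is the least $k\ge0$ with $\mathrm{LS}_+^k(G)=\mathrm{STAB}(G)$. For $k\ge 3$, $H_k''$ is the graph with vertex set $\{1_1,2_2\}\cup\{i_0,i_1,i_2: i\in\{3,\dots,k\}\}$ and edges: (i) $\{1_1,2_2\}$; (ii) $\{1_1,i_2\},\{2_2,i_1\},\{i_0,i_1\},\{i_0,i_2\}$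 for every $i\in\{3,\dots,k\}$; (iii) $\{i_2,j_1\}$ for all distinct $i,j\in\{3,\dots,k\}$ with $0<(j-i)\bmod (k-2)<\frac{k-2}{2}$; (iv) $\{i_2,j_1\}$ for all $i,j\in\{3,\dots,k\}$ with $j-i=\frac{k-2}{2}$. *)

(* Defs.v *)
From HB Require Import structures.
From mathcomp Require Import all_boot all_order all_algebra.
From mathcomp Require Import boolp classical_sets reals.
From mathcomp Require Import zify ring lra.

Set Implicit Arguments.
Unset Strict Implicit.
Unset Printing Implicit Defensive.

Import Order.TTheory GRing.Theory Num.Theory.

Local Open Scope classical_set_scope.
Local Open Scope ring_scope.

Record sgraph := SGraph {
  vertices :> finType;
  edge : rel vertices;
  edge_sym : symmetric edge;
  edge_irr : irreflexive edge }.

Definition degree (G : sgraph) (v : G) : nat := #|edge v|.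

Definition stable (G : sgraph) (S : {set G}) : Prop :=
  {in S &, forall u v, ~~ edge u v}.

Definition incidence (R : realType) (V : finType) (S : {set V}) :
    {ffun V -> R} :=
  [ffun v => (v \in S)%:R].

Definition convex_hull (R : realType) (V : finType) (A : set {ffun V -> R}) :
    set {ffun V -> R} :=
  [set x | exists (n : nat) (p : 'I_n -> {ffun V -> R}) (w : 'I_n -> R),
    [/\ forall t, A (p t), forall t, 0 <= w t, \sum_t w t = 1
      & x = [ffun v => \sum_t w t * p t v]]].

Definition STAB (R : realType) (G : sgraph) : set {ffun G -> R} :=
  convex_hull (@incidence R G @` [set S | stable S]).
Arguments STAB : clear implicits.

Definition FRAC (R : realType) (G : sgraph) : set {ffun G -> R} :=
  [set x | (forall i, 0 <= x i <= 1) /\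
           (forall i j, edge i j -> x i + x j <= 1)].
Arguments FRAC : clear implicits.

(* R^(n+1) is {ffun option V -> R}: the extra coordinate 0 is None. *)
Definition homog (R : realType) (V : finType) (x : {ffun V -> R}) :
    {ffun option V -> R} :=
  [ffun a => if a is Some i then x i else 1].

Definition cone (R : realType) (V : finType) (P : set {ffun V -> R}) :
    set {ffun option V -> R} :=
  [set y | exists (l : R) (x : {ffun V -> R}),
    [/\ 0 <= l, P x & y = [ffun a => l * homog x a]]].

Definition psd (R : realType) (I : finType) (Y : I -> I -> R) : Prop :=
  forall z : I -> R, 0 <= \sum_a \sum_b z a * Y a b * z b.

(* The third clause is Y e_0 = diag Y; the last two vectors are the column
   Y e_i and Y (e_0 - e_i). *)
Definition LS_hat (R : realType) (V : finType) (P : set {ffun V -> R}) :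
    set (option V -> option V -> R) :=
  [set Y | [/\ forall a b, Y a b = Y b a,
               psd Y,
               forall a, Y a None = Y a a &
               forall i : V,
                 cone P [ffun a => Y a (Some i)] /\
                 cone P [ffun a => Y a None - Y a (Some i)]]].

Definition LS_plus (R : realType) (V : finType) (P : set {ffun V -> R}) :
    set {ffun V -> R} :=
  [set x | exists2 Y, LS_hat P Y & [ffun a => Y a None] = homog x].

Definition LS_plus_iter (R : realType) (G : sgraph) (k : nat) :
    set {ffun G -> R} :=
  iter k (@LS_plus R G) (FRAC R G).
Arguments LS_plus_iter : clear implicits.

Section RankExists.
Variables (R : realType).

Lemma convex_hull_conv (V : finType) (A : set {ffun V -> R}) (l : R)
    (x y : {ffun V -> R}) :
  0 <= l <= 1 -> convex_hull A x -> convex_hull A y ->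
  convex_hull A [ffun v => l * x v + (1 - l) * y v].
Proof.
move=> /andP[l0 l1] [n [p [w [pA w0 w1 ->]]]] [m [q [u [qA u0 u1 ->]]]].
exists (n + m)%N, (fun t => match split t with inl i => p i | inr j => q j end),
  (fun t => match split t with inl i => l * w i | inr j => (1 - l) * u j end).
have sl (i : 'I_n) : split (lshift m i) = inl i.
  exact: (unsplitK (inl i)).
have sr (j : 'I_m) : split (rshift n j) = inr j.
  exact: (unsplitK (inr j)).
split.
- by move=> t; case: (split t).
- by move=> t; case: (split t) => i; rewrite mulr_ge0 // subr_ge0.
- rewrite big_split_ord /=.
  under eq_bigr do rewrite sl.
  under [X in _ + X]eq_bigr do rewrite sr.
  by rewrite -!mulr_sumr w1 u1 !mulr1 subrKC.
- apply/ffunP=> v; rewrite !ffunE big_split_ord /= !mulr_sumr.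
  by congr (_ + _); apply: eq_bigr => i _; rewrite ?sl ?sr mulrA.
Qed.

Variable G : sgraph.
Local Notation STAB := (STAB R G).
Local Notation FRAC := (FRAC R G).
Local Notation LSk := (LS_plus_iter R G).

Lemma incidence_FRAC (S : {set G}) : stable S -> FRAC (incidence R S).
Proof.
move=> st; split=> [i|i j eij]; rewrite !ffunE.
  by case: (i \in S); rewrite ?lexx ler01.
case: (boolP (i \in S)) => iS; case: (boolP (j \in S)) => jS;
  rewrite ?addr0 ?add0r ?ler01 //.
by have := st _ _ iS jS; rewrite eij.
Qed.

Lemma STAB_FRAC : STAB `<=` FRAC.
Proof.
move=> _ [n [p [w [pA w0 w1 ->]]]].
have pF t : FRAC (p t) by have [S st <-] := pA t; exact: incidence_FRAC.
split=> [i|i j eij]; rewrite !ffunE.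
  apply/andP; split.
    apply: sumr_ge0 => t _; apply: mulr_ge0 => //.
    by have [/(_ i)/andP[]] := pF t.
  rewrite -w1; apply: ler_sum => t _; rewrite ler_piMr //.
  by have [/(_ i)/andP[]] := pF t.
rewrite -big_split /= -w1; apply: ler_sum => t _; rewrite -mulrDr ler_piMr //.
by have [_ /(_ i j eij)] := pF t.
Qed.

Lemma comb_cone (P : set {ffun G -> R}) n (p : 'I_n -> {ffun G -> R})
    (c : 'I_n -> R) x0 :
  P x0 -> STAB `<=` P ->
  (forall t, (@incidence R G @` [set S | stable S]) (p t)) ->
  (forall t, 0 <= c t) -> cone P [ffun a => \sum_t c t * homog (p t) a].
Proof.
move=> Px0 SP pA c0; have l0 : 0 <= \sum_t c t by exact: sumr_ge0.
case: (eqVneq (\sum_t c t) 0) => [s0|sn0].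
  exists 0, x0; split=> //; apply/ffunP=> a; rewrite !ffunE mul0r big1 // => t _.
  by rewrite (psumr_eq0P (fun t _ => c0 t) s0) // mul0r.
exists (\sum_t c t), [ffun v => \sum_t (c t / \sum_t c t) * p t v]; split=> //.
  apply: SP; exists n, p, (fun t => c t / \sum_t c t); split=> //.
    by move=> t; rewrite divr_ge0.
  by rewrite -mulr_suml divff.
apply/ffunP=> a; rewrite !ffunE.
case: a => [i|].
  rewrite ffunE mulr_sumr; apply: eq_bigr => t _.
  by rewrite !ffunE mulrA mulrCA divff // mulr1.
by rewrite mulr1; apply: eq_bigr => t _; rewrite !ffunE mulr1.
Qed.

Lemma STAB_LS (P : set {ffun G -> R}) : STAB `<=` P -> STAB `<=` LS_plus P.
Proof.
move=> SP x Sx; have Px := SP _ Sx.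
case: Sx => n [p [w [pA w0 w1 ex]]].
pose h t := homog (p t).
have h01 t a : h t a * h t a = h t a /\ 0 <= h t a <= 1.
  rewrite /h ffunE; case: a => [i|]; last by rewrite mulr1 ler01 lexx.
  have [S _ <-] := pA t; rewrite ffunE.
  by case: (i \in S); rewrite ?mulr1 ?mulr0 ?lexx ?ler01.
have h0 t : h t None = 1 by rewrite /h ffunE.
exists (fun a b => \sum_t w t * h t a * h t b); last first.
  apply/ffunP=> a; rewrite !ffunE.
  case: a => [i|].
    rewrite ex ffunE; apply: eq_bigr => t _.
    by rewrite h0 mulr1 /h !ffunE.
  by rewrite -w1; apply: eq_bigr => t _; rewrite !h0 !mulr1.
split.
- by move=> a b; apply: eq_bigr => t _; rewrite mulrAC.
- move=> z.
  have -> : \sum_a \sum_b z a * (\sum_t w t * h t a * h t b) * z b =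
      \sum_t w t * (\sum_a z a * h t a) ^+ 2.
    under eq_bigr do under eq_bigr do rewrite mulr_sumr mulr_suml.
    under eq_bigr do rewrite exchange_big /=.
    rewrite exchange_big /=; apply: eq_bigr => t _.
    rewrite expr2 mulr_suml mulr_sumr; apply: eq_bigr => a _.
    rewrite !mulr_sumr; apply: eq_bigr => b _; ring.
  by apply: sumr_ge0 => t _; rewrite mulr_ge0 // sqr_ge0.
- move=> a; apply: eq_bigr => t _; rewrite h0 mulr1 -mulrA.
  by have [-> _] := h01 t a.
- move=> i; split.
    have -> : [ffun a => \sum_t w t * h t a * h t (Some i)] =
        [ffun a => \sum_t (w t * h t (Some i)) * homog (p t) a].
      apply/ffunP=> a; rewrite [LHS]ffunE [RHS]ffunE; apply: eq_bigr => t _.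
      by rewrite -/(h t) mulrAC.
    apply: (comb_cone Px) => // t; rewrite mulr_ge0 //.
    by have [_ /andP[]] := h01 t (Some i).
  have -> : [ffun a => \sum_t w t * h t a * h t None
                       - \sum_t w t * h t a * h t (Some i)] =
      [ffun a => \sum_t (w t * (1 - h t (Some i))) * homog (p t) a].
    apply/ffunP=> a; rewrite [LHS]ffunE [RHS]ffunE -sumrB.
    by apply: eq_bigr => t _; rewrite h0 -/(h t); ring.
  apply: (comb_cone Px) => // t; rewrite mulr_ge0 // subr_ge0.
  by have [_ /andP[]] := h01 t (Some i).
Qed.

Lemma STAB_LSk k : STAB `<=` LSk k.
Proof. by elim: k => [|k IH]; [exact: STAB_FRAC | exact: STAB_LS]. Qed.

Lemma LS_plus_split (P : set {ffun G -> R}) x i :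
  P `<=` FRAC -> LS_plus P x ->
  0 <= x i <= 1 /\ exists y z, [/\ P y, P z,
    x = [ffun j => x i * y j + (1 - x i) * z j], x i != 0 -> y i = 1
    & x i != 1 -> z i = 0].
Proof.
move=> PF [Y [sym _ dg /(_ i)[c1 c2]] Y0].
have {}Y0 a : Y a None = homog x a by rewrite -Y0 ffunE.
case: c1 => l [y [l0 Py ey]]; case: c2 => m [z [m0 Pz ez]].
have {}ey a : Y a (Some i) = l * homog y a.
  by have /ffunP/(_ a) := ey; rewrite !ffunE.
have {}ez a : homog x a - Y a (Some i) = m * homog z a.
  by have /ffunP/(_ a) := ez; rewrite !ffunE Y0 ffunE.
have lE : l = x i by have := ey None; rewrite sym Y0 !ffunE mulr1.
have mE : m = 1 - x i.
  by have := ez None; rewrite sym Y0 !ffunE mulr1.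
have xi : x i = l * y i by have := ey (Some i); rewrite -dg Y0 !ffunE.
have zi : m * z i = 0.
  by have := ez (Some i); rewrite -dg Y0 !ffunE subrr.
split; first by rewrite -lE l0 /= lE -subr_ge0 -mE.
exists y, z; split=> //.
- apply/ffunP => j; rewrite !ffunE.
  have := ez (Some j); rewrite ey !ffunE lE mE => /eqP.
  by rewrite subr_eq addrC => /eqP.
- by move=> x0; apply: (mulfI x0); rewrite mulr1 {2}xi lE.
- move=> x1; apply/eqP; move/eqP: zi; rewrite mulf_eq0 mE subr_eq0 eq_sym.
  by rewrite (negPf x1).
Qed.

Lemma LS_FRAC (P : set {ffun G -> R}) : P `<=` FRAC -> LS_plus P `<=` FRAC.
Proof.
move=> PF x Lx; split=> [i|i j eij].
  by have [] := LS_plus_split i PF Lx.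
have [/andP[x0 x1] [y [z [/PF[_ Fy] /PF[_ Fz] xE _ _]]]] :=
  LS_plus_split i PF Lx.
have := Fy _ _ eij; have := Fz _ _ eij.
have ev v : x v = x i * y v + (1 - x i) * z v by rewrite {1}xE ffunE.
rewrite (ev j) {1}(ev i); move: x0 x1; move: (x i) => l; nra.
Qed.

Lemma LSk_FRAC k : LSk k `<=` FRAC.
Proof. by elim: k => [|k IH] //; exact: LS_FRAC. Qed.

Definition fractional (x : {ffun G -> R}) : pred G :=
  [pred i | (x i != 0) && (x i != 1)].

Lemma integral_STAB x : FRAC x -> #|fractional x| = 0%N -> STAB x.
Proof.
move=> [Fx Ex] /card0_eq nf.
have xE : x = incidence R [set i | x i == 1].
  apply/ffunP=> i; rewrite ffunE inE; have := nf i; rewrite !inE.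
  by case: (eqVneq (x i) 0) => [->|_] /=; [rewrite eq_sym oner_eq0|
    case: eqVneq => [->|]].
exists 1%N, (fun=> x), (fun=> 1); split=> //.
- move=> _; exists [set i | x i == 1]%SET => // u v; rewrite !inE => /eqP xu /eqP xv.
  by apply/negP => /Ex; rewrite xu xv; lra.
- by rewrite big_ord1.
- by apply/ffunP=> v; rewrite ffunE big_ord1 mul1r.
Qed.

Lemma LSk_STAB k x : LSk k x -> (#|fractional x| <= k)%N -> STAB x.
Proof.
elim: k x => [|k IH] x Lx fx.
  by apply: integral_STAB => //; apply/eqP; rewrite -leqn0.
case: (posnP #|fractional x|) => [f0|/card_gt0P[i fi]].
  exact: integral_STAB (LSk_FRAC Lx) f0.
have [x01 [y [z [Ly Lz xE yi zi]]]] := LS_plus_split i (@LSk_FRAC k) Lx.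
have /andP[xn0 xn1] := fi.
have [[Fy _] [Fz _]] := (LSk_FRAC Ly, LSk_FRAC Lz).
have sub (u : {ffun G -> R}) : (forall j, x j = 0 -> u j = 0) ->
    (forall j, x j = 1 -> u j = 1) -> ~~ fractional u i ->
    (#|fractional u| <= k)%N.
  move=> u0 u1 ui; rewrite -ltnS; apply: leq_trans fx.
  apply: proper_card; apply/properP; split; last by exists i.
  apply/fintype.subsetP => j; rewrite !inE => /andP[un0 un1].
  by apply/andP; split; [apply: contra un0|apply: contra un1];
     move=> /eqP xj; apply/eqP; [exact: u0|exact: u1].
have [p0 p1] : 0 < x i /\ 0 < 1 - x i.
  by rewrite subr_gt0 !lt_neqAle eq_sym xn0 xn1; case/andP: x01.
have ev j : x j = x i * y j + (1 - x i) * z j by rewrite {1}xE !ffunE.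
rewrite xE; apply: convex_hull_conv => //.
  apply: IH => //; apply: sub.
  - by move=> j xj; have := ev j; have /andP[? _] := Fy j;
       have /andP[? _] := Fz j; rewrite xj; nra.
  - by move=> j xj; have := ev j; have /andP[_ ?] := Fy j;
       have /andP[_ ?] := Fz j; rewrite xj; nra.
  - by rewrite /fractional /= yi // eqxx andbF.
apply: IH => //; apply: sub.
- by move=> j xj; have := ev j; have /andP[? _] := Fy j;
     have /andP[? _] := Fz j; rewrite xj; nra.
- by move=> j xj; have := ev j; have /andP[_ ?] := Fy j;
     have /andP[_ ?] := Fz j; rewrite xj; nra.
- by rewrite /fractional /= zi // eqxx.
Qed.

Lemma LS_rank_exists : exists k, `[< LSk k = STAB >].
Proof.
exists #|G|; apply/asboolP; apply/seteqP; split; last exact: STAB_LSk.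
by move=> x /LSk_STAB; apply; exact: max_card.
Qed.

End RankExists.

Definition LS_rank (R : realType) (G : sgraph) : nat :=
  ex_minn (LS_rank_exists R G).

(* The vertex i_c is the pair (i, c). *)
Definition Hpp_vertex (k : nat) : pred ('I_k.+1 * 'I_3) :=
  fun v => let: (i, c) := v in
    [|| (i == 1 :> nat) && (c == 1 :> nat),
        (i == 2 :> nat) && (c == 2 :> nat)
      | (3 <= i)%N].

(* Adjacency of i_a and j_b, in one orientation.  For 3 <= i, j <= k the
   truncated difference j + (k - 2) - i is exact, and is j - i modulo k - 2;
   both sides of the comparisons with (k - 2) / 2 are doubled. *)
Definition Hpp_arc (k i a j b : nat) : bool :=
  [|| [&& i == 1, a == 1, j == 2 & b == 2],
      [&& i == 1, a == 1, 3 <= j & b == 2],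
      [&& i == 2, a == 2, 3 <= j & b == 1],
      [&& 3 <= i, j == i, a == 0 & (b == 1) || (b == 2)],
      [&& 3 <= i, 3 <= j, i != j, a == 2, b == 1
        & 0 < 2 * ((j + (k - 2) - i) %% (k - 2)) < k - 2]
    | [&& 3 <= i, 3 <= j, a == 2, b == 1 & 2 * j == 2 * i + (k - 2)]]%N.

Definition Hpp_edge (k : nat) : rel {v | @Hpp_vertex k v} :=
  fun u v =>
    let: (i, a) := val u in let: (j, b) := val v in
    Hpp_arc k i a j b || Hpp_arc k j b i a.

Lemma Hpp_edge_sym k : symmetric (@Hpp_edge k).
Proof.
by move=> [[i a] pu] [[j b] pv]; rewrite /Hpp_edge /= orbC.
Qed.

Lemma Hpp_edge_irr k : irreflexive (@Hpp_edge k).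
Proof.
move=> [[i a] pu]; rewrite /Hpp_edge /= orbb /Hpp_arc {pu}; lia.
Qed.

Definition Hpp (k : nat) : sgraph :=
  SGraph (@Hpp_edge_sym k) (@Hpp_edge_irr k).

(* Main.v *)
Require Import Defs.
From mathcomp Require Import all_boot all_order all_algebra.
From mathcomp Require Import boolp classical_sets reals.
From mathcomp Require Import zify ring lra.

Set Implicit Arguments.
Unset Strict Implicit.
Unset Printing Implicit Defensive.

Import Order.TTheory GRing.Theory Num.Theory.

(** Stretching a vertex [v] of [G] replaces it by a star whose leaves share out
    the neighbours of [v].  Giving the leaves the value x_v and the centre the
    value 1 - x_v sends FRAC, and then each LS_+^k, of [G] into that of the
    stretched graph: a certificate [Y] is transported to L Y L^T, where the rows
    of L are e_0, e_u or e_0 - e_u, so that its columns are images of the columns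
    Y e_u and Y (e_0 - e_u).  Conversely the leaf-centre edges are tight at the
    image of [x], so stable sets of the stretched graph representing this image
    come from stable sets of [G].  Hence stretching does not decrease the rank.
    A vertex of degree d >= 4 can be stretched into vertices of degree at most 3
    at the cost of at most d - 2 new vertices; for H_k'' this amounts to at most
    k^2 - 4 vertices in total, and isolated vertices make up the difference. *)

(** * Transport of certificates along maps to literals *)

Section LiteralMap.
Local Open Scope ring_scope.
Variables (R : realType) (V W : finType) (pi : W -> V * bool).

Definition literal_coef (a : option W) (c : option V) : R :=
  match a with
  | None => (c == None)%:R
  | Some w => if (pi w).2 then (c == Some (pi w).1)%:R
              else (c == None)%:R - (c == Some (pi w).1)%:R
  end.

Definition lift_literals (y : option V -> R) (a : option W) : R :=
  \sum_c literal_coef a c * y c.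

Definition eval_literals (x : {ffun V -> R}) : {ffun W -> R} :=
  [ffun w => if (pi w).2 then x (pi w).1 else 1 - x (pi w).1].

Lemma sum_delta (c0 : option V) (y : option V -> R) :
  \sum_c (c == c0)%:R * y c = y c0.
Proof.
rewrite (bigD1 c0) //= eqxx mul1r big1 ?addr0 // => c /negPf ->.
by rewrite mul0r.
Qed.

Lemma lift_literals_None y : lift_literals y None = y None.
Proof. exact: sum_delta. Qed.

Lemma lift_literals_Some y w : lift_literals y (Some w) =
  if (pi w).2 then y (Some (pi w).1) else y None - y (Some (pi w).1).
Proof.
rewrite /lift_literals /=; case: (pi w).2; first exact: sum_delta.
under eq_bigr do rewrite mulrBl.
by rewrite sumrB !sum_delta.
Qed.

(** [lift_literals] is linear and sends [homog x] to [homog (eval_literals x)], so the scalar [l] is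
    kept. *)
Lemma lift_literals_cone (P : set {ffun V -> R}) (Q : set {ffun W -> R}) y :
  (forall x, P x -> Q (eval_literals x)) -> cone P [ffun c => y c] ->
  cone Q [ffun a => lift_literals y a].
Proof.
move=> PQ [l [x [l0 Px ey]]]; exists l, (eval_literals x); split=> //.
  exact: PQ.
have {}ey c : y c = l * homog x c by have /ffunP/(_ c) := ey; rewrite !ffunE.
apply/ffunP=> -[w|]; rewrite !ffunE.
  by rewrite lift_literals_Some !ey !ffunE; case: (pi w).2; ring.
by rewrite lift_literals_None ey ffunE.
Qed.

Lemma LS_plus_literals (P : set {ffun V -> R}) (Q : set {ffun W -> R}) x :
  (forall x, P x -> Q (eval_literals x)) -> LS_plus P x ->
  LS_plus Q (eval_literals x).
Proof.
move=> PQ [Y [sym Ypsd dg cones] Y0].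
have {}Y0 c : Y c None = homog x c by rewrite -Y0 ffunE.
pose M := literal_coef; pose L := lift_literals.
(* The entries of L Y L^T, with [literal_coef] as the matrix L. *)
pose Z a b := \sum_c \sum_d M a c * Y c d * M b d.
have ZE a b : Z a b = L (fun c => L (fun d => Y c d) b) a.
  rewrite /Z /L /lift_literals; apply: eq_bigr => c _; rewrite mulr_sumr.
  by apply: eq_bigr => d _; rewrite /M; ring.
have Zsym a b : Z a b = Z b a.
  rewrite /Z exchange_big; apply: eq_bigr => c _; apply: eq_bigr => d _.
  by rewrite sym; ring.
have ZN a : Z a None = L (fun c => Y c None) a.
  by rewrite ZE; congr L; apply: funext => c; rewrite /L lift_literals_None.
have ZS a w : Z a (Some w) = L (fun c => if (pi w).2 then Y c (Some (pi w).1)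
    else Y c None - Y c (Some (pi w).1)) a.
  by rewrite ZE; congr L; apply: funext => c; rewrite /L lift_literals_Some.
have LB y z a : L y a - L z a = L (fun c => y c - z c) a.
  by rewrite /L /lift_literals -sumrB; apply: eq_bigr => c _; rewrite mulrBr.
exists Z; last first.
  apply/ffunP=> -[w|]; rewrite !ffunE ZN /L.
    by rewrite lift_literals_Some !Y0 !ffunE.
  by rewrite lift_literals_None Y0 ffunE.
split=> //.
(* The quadratic form of [Z] at [z] is that of [Y] at L^T z. *)
- move=> z; have := Ypsd (fun c => \sum_a z a * M a c).
  congr (_ <= _).
  transitivity (\sum_c \sum_d \sum_a \sum_b
      z a * (M a c * Y c d * M b d) * z b).
    apply: eq_bigr => c _; apply: eq_bigr => d _.
    rewrite mulr_suml mulr_suml; apply: eq_bigr => a _.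
    by rewrite mulr_sumr; apply: eq_bigr => b _; ring.
  under eq_bigr do rewrite exchange_big.
  rewrite exchange_big; apply: eq_bigr => a _.
  under eq_bigr do rewrite exchange_big.
  rewrite exchange_big; apply: eq_bigr => b _.
  rewrite mulr_sumr mulr_suml; apply: eq_bigr => c _.
  by rewrite mulr_sumr mulr_suml.
(* For a negative literal the diagonal entry is Y_00 - 2 Y_0u + Y_uu, which equals Y_00 - Y_u0
   because Y_uu = Y_u0. *)
- case=> [w|] //; rewrite ZN ZS /L !lift_literals_Some.
  case: (pi w).2; first by rewrite dg.
  by rewrite (sym None (Some _)) -(dg (Some _)); ring.
(* A negative literal exchanges the two cone conditions at u, since Y e_0 - (Y e_0 - Y e_u) = Y
   e_u. *)
- move=> w; have [c1 c2] := cones (pi w).1; split.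
    under [X in cone _ X]eq_ffun do rewrite ZS.
    by apply: (lift_literals_cone PQ); case: (pi w).2.
  under [X in cone _ X]eq_ffun do rewrite ZS ZN LB.
  apply: (lift_literals_cone PQ); case: (pi w).2 => //.
  by under [X in cone _ X]eq_ffun do rewrite subKr.
Qed.

End LiteralMap.

(* [pi] reads each vertex of [H] as a literal over [V(G)], [(u, true)] standing
   for x_u and [(u, false)] for 1 - x_u. *)
Lemma LS_rank_literals (R : realType) (G H : sgraph) (pi : H -> G * bool)
    (rep : G -> H) :
  (forall u, pi (rep u) = (u, true)) ->
  (forall a b, edge a b ->
     [&& (pi a).2, (pi b).2 & edge (pi a).1 (pi b).1]
     || ((pi a).1 == (pi b).1) && ((pi a).2 != (pi b).2)) ->
  (forall S : {set H}, stable S ->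
     (forall a b, edge a b -> (pi a).2 != (pi b).2 ->
        (a \in S) = (b \notin S)) ->
     stable [set u | rep u \in S]) ->
  LS_rank R G <= LS_rank R H.
Proof.
move=> repK edgeP stabP.
pose f := @eval_literals R G H pi.
have link a b : edge a b -> (pi a).2 != (pi b).2 -> (pi a).1 = (pi b).1.
  by move=> /edgeP/orP[/and3P[-> -> _] //|/andP[/eqP]].
have fF x : FRAC R G x -> FRAC R H (f x).
  move=> [x01 xE]; split=> [a|a b /edgeP].
    rewrite ffunE; have /andP[? ?] := x01 (pi a).1.
    by case: (pi a).2; apply/andP; split=> //; lra.
  rewrite !ffunE => /orP[/and3P[-> -> /xE] //|/andP[/eqP-> ]].
  by case: (pi a).2; case: (pi b).2 => // _; lra.
have fL n x : LS_plus_iter R G n x -> LS_plus_iter R H n (f x).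
  elim: n x => [|n IH] x; first exact: fF.
  exact: LS_plus_literals.
have fS x : STAB R H (f x) -> STAB R G x.
  move=> [n [p [w [pA w0 w1 fx]]]].
  have fE a : f x a = (\sum_t w t * p t a)%R by rewrite fx ffunE.
  (* The ends of this edge carry x_u and 1 - x_u for one u, so [f x] sums to 1 on it. Each [p t]
     sums to at most 1, hence to exactly 1 where the weight is nonzero. *)
  have tight t a b : w t != 0%R -> edge a b -> (pi a).2 != (pi b).2 ->
      (p t a + p t b = 1)%R.
    move=> wt ab sg.
    have pF s : (0 <= w s * (1 - p s a - p s b))%R.
      rewrite mulr_ge0 //; have [S st <-] := pA s.
      by have [_ /(_ _ _ ab)] := incidence_FRAC R st; lra.
    have s0 : (\sum_s w s * (1 - p s a - p s b) = 0)%R.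
      under eq_bigr do rewrite !mulrBr mulr1.
      rewrite !sumrB w1 -!fE !ffunE (link a b ab sg).
      by move: sg; case: (pi a).2; case: (pi b).2 => // _; ring.
    have /eqP : (w t * (1 - p t a - p t b) = 0)%R.
      exact: psumr_eq0P (fun s _ => pF s) s0 _ isT.
    by rewrite mulf_eq0 (negPf wt) /= => /eqP; lra.
  (* Tightness is unknown for terms of weight zero; the empty set stands in for them. *)
  exists n, (fun t => if w t == 0%R then incidence R (finset.set0 : {set G})
    else [ffun u => p t (rep u)]), w; split=> //.
    move=> t; case: eqVneq => [_|wt].
      by exists finset.set0 => // u v; rewrite inE.
    have [S st pS] := pA t; exists [set u | rep u \in S]%SET.
      apply: stabP => // a b ab sg; have := tight t a b wt ab sg.
      rewrite -pS !ffunE; case: (a \in S); case: (b \in S) => //=; lra.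
    by apply/ffunP=> u; rewrite -pS !ffunE inE.
  apply/ffunP=> u; have := fE (rep u); rewrite !ffunE repK /= => ->.
  apply: eq_bigr => t _; case: eqVneq => [->|_]; first by rewrite !mul0r.
  by rewrite ffunE.
rewrite /LS_rank; case: ex_minnP => m _ minG; case: ex_minnP => n /asboolP eqH _.
apply: minG; apply/asboolP/seteqP; split; last exact: STAB_LSk.
by move=> x /fL; rewrite eqH => /fS.
Qed.

(** * Stretching a vertex into a star *)

Section Stretch.
Variables (G : sgraph) (v : G) (J : finType) (c : G -> option J).

(* Vertex [v] becomes a star with centre [inr None]: its leaves are [inl v] and
   the [inr (Some j)], and the neighbour [w] of [v] is attached to leaf [c w]. *)
Definition stretch_edge : rel (G + option J)%type := fun a b =>
  match a, b with
  | inl u, inl w => [&& edge u w, (u == v) ==> (c w == None)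
                      & (w == v) ==> (c u == None)]
  | inl w, inr (Some j) | inr (Some j), inl w => edge v w && (c w == Some j)
  | inl u, inr None | inr None, inl u => u == v
  | inr None, inr (Some _) | inr (Some _), inr None => true
  | inr None, inr None | inr (Some _), inr (Some _) => false
  end.

Lemma stretch_edge_sym : symmetric stretch_edge.
Proof.
move=> [u|[j|]] [w|[i|]] //=; rewrite edge_sym; congr (_ && _).
by rewrite andbC.
Qed.

Lemma stretch_edge_irr : irreflexive stretch_edge.
Proof. by move=> [u|[j|]] //=; rewrite edge_irr. Qed.

Definition stretch : sgraph := SGraph stretch_edge_sym stretch_edge_irr.

Lemma card_stretch : #|stretch| = #|G| + #|J|.+1.
Proof. by rewrite card_sum card_option. Qed.

(** A stable set tight on the star contains all leaves or none, and every neighbour of [v] is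
    attached to some leaf, so no edge at [v] is lost when the set is pulled back. *)
Lemma LS_rank_stretch (R : realType) : LS_rank R G <= LS_rank R stretch.
Proof.
pose pi (a : stretch) : G * bool := match a with
  | inl u => (u, true) | inr (Some _) => (v, true) | inr None => (v, false) end.
apply: (@LS_rank_literals R G stretch pi inl) => //.
  move=> [u|[j|]] [w|[i|]] //=; rewrite ?eqxx ?orbT //.
  - by case/and3P=> ->.
  - by case/andP; rewrite edge_sym => ->.
  - by move=> ->.
  - by case/andP=> ->.
  - by rewrite eq_sym => ->.
move=> S st link.
have vS j : (inr (Some j) : stretch) \in S = ((inl v : stretch) \in S).
  by rewrite (link _ (inr None)) // [RHS](link _ (inr None)) //= eqxx.
have noedge w : (inl v : stretch) \in S -> (inl w : stretch) \in S ->
    ~~ edge v w.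
  move=> Sv Sw; apply/negP => vw; case cw: (c w) => [j|].
    have /(st _ _)/(_ Sw)/negP : (inr (Some j) : stretch) \in S by rewrite vS.
    by apply; rewrite /= vw cw eqxx.
  (* With [c w = None], the edge joins [w] to the leaf [inl v] itself. *)
  have /negP := st _ _ Sv Sw; apply; rewrite /= vw cw eqxx implybT /=.
  by apply/implyP => /eqP wv; move: vw; rewrite wv edge_irr.
move=> u w; rewrite !inE => Su Sw.
have [uv|uv] := eqVneq u v; first by rewrite uv noedge // -uv.
have [wv|wv] := eqVneq w v; first by rewrite wv edge_sym noedge // -wv.
by have := st _ _ Su Sw; rewrite /= (negPf uv) (negPf wv) /= !andbT.
Qed.

End Stretch.

Lemma sum_nat_of_bool (T : finType) (P : pred T) : \sum_x (P x : nat) = #|P|.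
Proof. by rewrite -sum1_card [RHS]big_mkcond. Qed.

Lemma degreeE (G : sgraph) (v : G) : degree v = \sum_w (edge v w : nat).
Proof. by rewrite sum_nat_of_bool. Qed.

(** * Degrees after stretching, and reduction to maximum degree 3 *)

Section StretchDegree.
Variables (G : sgraph) (v : G) (J : finType) (c : G -> option J).
Local Notation H := (stretch v c).

Lemma sum_option (F : option J -> nat) :
  \sum_a F a = F None + \sum_j F (Some j).
Proof.
rewrite (bigD1 None) //=; congr (_ + _).
by rewrite (reindex_omap Some id) => [|[]] //=; apply: eq_bigl => j; rewrite eqxx.
Qed.

Lemma stretch_degree (a : H) : degree a =
  \sum_w (edge a (inl w : H) : nat)
    + ((edge a (inr None : H) : nat) + \sum_j (edge a (inr (Some j) : H) : nat)).
Proof. by rewrite degreeE big_sumType sum_option. Qed.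

Lemma stretch_degree_other u : u != v -> degree (inl u : H) = degree u.
Proof.
move=> uv; rewrite stretch_degree /= (negPf uv) degreeE add0n /=.
rewrite (bigD1 v) //= [RHS](bigD1 v) //= eqxx /= addnAC.
congr (_ + _); last first.
  by apply: eq_bigr => w /negPf -> /=; rewrite andbT.
rewrite [edge v u]edge_sym; case: (edge u v) => /=; last by rewrite big1_eq.
case: (c u) => [j|]; last by rewrite big1_eq.
by rewrite (bigD1 j) //= eqxx big1 // => i /negPf ij; rewrite eqE /= eq_sym ij.
Qed.

Lemma stretch_degree_root :
  degree (inl v : H) = (\sum_w (edge v w && (c w == None) : nat)).+1.
Proof.
rewrite stretch_degree /= eqxx /= edge_irr big1_eq addn1; congr _.+1.
apply: eq_bigr => w _; have [->|_] := eqVneq w v; rewrite ?edge_irr //.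
by rewrite andbT.
Qed.

Lemma stretch_degree_leaf j : degree (inr (Some j) : H) =
  (\sum_w (edge v w && (c w == Some j) : nat)).+1.
Proof. by rewrite stretch_degree /= big1_eq addn1. Qed.

Lemma stretch_degree_centre : degree (inr None : H) = #|J|.+1.
Proof.
rewrite stretch_degree /= sum1_card add0n (bigD1 v) //= eqxx.
by rewrite big1 // => w /negPf ->.
Qed.

End StretchDegree.

(* Bounds the number of vertices added when a vertex of degree d is stretched. *)
Definition excess (d : nat) : nat := if d <= 3 then 0 else d - 2.

Lemma leq_excess d e : d <= e -> excess d <= excess e.
Proof. by rewrite /excess; case: ifP => ?; case: ifP => ?; lia. Qed.

(** Each of [m] new leaves takes two neighbours of [v] and has degree at most 3, as has the centre,
    of degree m + 1. Only [inl v] can keep an excess: it retains the other neighbours and gains the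
    centre. *)
Lemma stretch_step (R : realType) (G : sgraph) (v : G) (m : nat) :
  0 < m <= 2 -> 2 * m <= degree v ->
  exists H : sgraph, [/\ #|H| = #|G| + m.+1, LS_rank R G <= LS_rank R H
    & \sum_(a : H) excess (degree a)
      <= \sum_(u | u != v) excess (degree u) + excess (degree v - 2 * m).+1].
Proof.
move=> m12 /card_geqP[s [us ss sv]].
(* Neighbours at positions 2j and 2j + 1 of [s] go to leaf j; those outside [s] stay at [inl v]. *)
pose c w : option 'I_m := if w \in s then insub (index w s)./2 else None.
have cS w : w \in s -> exists2 j, c w = Some j & (index w s)./2 = j.
  move=> ws; have lt : (index w s)./2 < m.
    by move: ws; rewrite -index_mem ss; lia.
  by exists (Ordinal lt) => //; rewrite /c ws insubT.
have leaf j : \sum_w (edge v w && (c w == Some j) : nat) <= 2.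
  apply: leq_trans (card_size [:: nth v s (2 * j); nth v s (2 * j).+1]).
  rewrite sum_nat_of_bool; apply/subset_leq_card/fintype.subsetP.
  move=> w /andP[_ /eqP cw]; have ws : w \in s by move: cw; rewrite /c; case: ifP.
  have [i] := cS w ws; rewrite cw => -[<-] ij.
  have : (index w s == 2 * j) || (index w s == (2 * j).+1) by lia.
  by rewrite !inE => /orP[] /eqP <-; rewrite nth_index ?eqxx ?orbT.
have root : \sum_w (edge v w && (c w == None) : nat) <= degree v - 2 * m.
  have <- : #|[predI edge v & mem s]| = 2 * m.
    rewrite -ss -(card_uniqP us); apply: eq_card => w.
    by apply: andb_idl => /sv.
  rewrite sum_nat_of_bool /degree -(cardID (mem s) (edge v)) addKn.
  apply/subset_leq_card/fintype.subsetP => w /andP[vw cw]; apply/andP; split=> //.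
  by apply/negP => /cS[j cj _]; move: cw; rewrite cj.
exists (stretch v c); split.
- by rewrite card_stretch card_ord.
- exact: LS_rank_stretch.
- rewrite big_sumType /= sum_option stretch_degree_centre card_ord.
  rewrite [X in _ + (_ + X)]big1 ?addn0; last first.
    by move=> j _; rewrite stretch_degree_leaf /excess ifT // ltnS leaf.
  rewrite {2}/excess ifT ?addn0; last by lia.
  rewrite (bigD1 v) //= addnC leq_add //.
    by apply: leq_sum => u uv; rewrite stretch_degree_other.
  by rewrite stretch_degree_root leq_excess.
Qed.

(** Induction on the total excess: a step adding j + 1 vertices lowers it by at least j + 1, so
    order plus total excess never grows. *)
Lemma cubic_stretching (R : realType) (G : sgraph) :
  exists H : sgraph, [/\ forall a : H, degree a <= 3,
    #|G| <= #|H| <= #|G| + \sum_(u : G) excess (degree u)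
    & LS_rank R G <= LS_rank R H].
Proof.
have [m] := ubnP (\sum_(u : G) excess (degree u)).
elim: m G => // m IH G; rewrite ltnS => Gm.
have [/forallP small|] := boolP [forall u : G, degree u <= 3].
  by exists G; split; rewrite // leqnn leq_addr.
rewrite negb_forall => /existsP[v]; rewrite -ltnNge => dv.
(* At degree 4, one new leaf: 2 new vertices remove an excess of 2. From degree 5 on, two new
   leaves: 3 new vertices lower the degree at [v] by 3. *)
have [j [j12 jd jx]] : exists j, [/\ 0 < j <= 2, 2 * j <= degree v
    & j.+1 + excess (degree v - 2 * j).+1 <= excess (degree v)].
  have [->|d4] := eqVneq (degree v) 4; first by exists 1.
  by exists 2; rewrite /excess; split=> //; case: ifP => ?; case: ifP => ?; lia.
have [K [cK rK eK]] := stretch_step R j12 jd.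
have eG : \sum_(u : G) excess (degree u) =
    excess (degree v) + \sum_(u | u != v) excess (degree u).
  by rewrite (bigD1 v).
have [|H [dH cH rH]] := IH K; first by lia.
exists H; split=> //; first by lia.
exact: leq_trans rK rH.
Qed.

(** * Adding isolated vertices *)

Section Padding.
Variables (G : sgraph) (m : nat).

Definition pad_edge : rel (G + 'I_m)%type := fun a b =>
  match a, b with inl u, inl w => edge u w | _, _ => false end.

Lemma pad_edge_sym : symmetric pad_edge.
Proof. by move=> [u|i] [w|j] //=; exact: edge_sym. Qed.

Lemma pad_edge_irr : irreflexive pad_edge.
Proof. by move=> [u|i] //=; exact: edge_irr. Qed.

Definition pad : sgraph := SGraph pad_edge_sym pad_edge_irr.

Lemma card_pad : #|pad| = #|G| + m.
Proof. by rewrite card_sum card_ord. Qed.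

Lemma pad_degree d : (forall u : G, degree u <= d) ->
  forall a : pad, degree a <= d.
Proof.
move=> Gd [u|i]; rewrite degreeE big_sumType /= !big1_eq ?addn0 //.
by rewrite -degreeE.
Qed.

Lemma LS_rank_pad (R : realType) : 0 < #|G| -> LS_rank R G <= LS_rank R pad.
Proof.
(* The new vertices are isolated, so any literal suits them; [u0] is an arbitrary choice. *)
move=> /card_gt0P[u0 _].
apply: (@LS_rank_literals R G pad
  (fun a => (if a is inl u then u else u0, true)) inl) => //.
  by move=> [u|i] [w|j] //= ->.
by move=> S st _ u w; rewrite !inE => Su Sw; exact: st Su Sw.
Qed.

End Padding.

(** * Degrees and total excess of H_k'' *)

Definition Hpp_adj (k i a j b : nat) : bool :=
  Hpp_arc k i a j b || Hpp_arc k j b i a.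

Definition Hpp_degree (k i a : nat) : nat :=
  Hpp_adj k i a 1 1 + Hpp_adj k i a 2 2
  + \sum_(3 <= j < k.+1)
      (Hpp_adj k i a j 0 + Hpp_adj k i a j 1 + Hpp_adj k i a j 2).

Lemma sum_Hpp (k : nat) (F : nat -> nat -> nat) : 2 <= k ->
  \sum_(v : Hpp k) F (val v).1 (val v).2
  = F 1 1 + F 2 2 + \sum_(3 <= j < k.+1) (F j 0 + F j 1 + F j 2).
Proof.
move=> k2; pose G (p : 'I_k.+1 * 'I_3) := F p.1 p.2.
transitivity (\sum_(p | Hpp_vertex p) G p).
  rewrite (reindex_omap (val : Hpp k -> _) insub); last first.
    by move=> p Vp; rewrite insubT.
  by apply: eq_bigl => -[p Vp] /=; rewrite insubT Vp /= eqxx.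
rewrite big_mkcond (eq_bigr (fun p => (fun i c =>
    if Hpp_vertex (i, c) then F i c else 0) p.1 p.2)); last by case.
rewrite -(pair_big xpredT xpredT (fun (i : 'I_k.+1) (c : 'I_3) =>
    if Hpp_vertex (i, c) then F i c else 0)) /=.
pose g i := (if 3 <= i then F i 0 else 0)
  + (if (i == 1) || (3 <= i) then F i 1 else 0)
  + (if (i == 2) || (3 <= i) then F i 2 else 0).
transitivity (\sum_(i < k.+1) g i).
  apply: eq_bigr => i _; rewrite !big_ord_recl big_ord0 /= addn0 addnA /g.
  by rewrite !andbF !andbT.
(* Row 0 is empty and rows 1 and 2 hold one vertex each; they are split off from the triples. *)
rewrite -(big_mkord xpredT g) 3?big_ltn //; last by lia.
rewrite {1 2 3}/g /= !addn0 !add0n addnA; congr (_ + _).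
by apply: eq_big_nat => j /andP[j3 _]; rewrite /g j3 !orbT.
Qed.

Lemma Hpp_degreeE (k : nat) (v : Hpp k) : 2 <= k ->
  degree v = Hpp_degree k (val v).1 (val v).2.
Proof.
move=> k2; rewrite degreeE /Hpp_degree.
rewrite -(sum_Hpp (fun j b => Hpp_adj k (val v).1 (val v).2 j b)) //.
apply: eq_bigr => -[[j b] Vw] _; rewrite /= /Hpp_edge /=.
by case: v => -[i a] Vv.
Qed.

Lemma sum_nat_eq_index m n i : m <= i < n -> \sum_(m <= j < n) (j == i : nat) = 1.
Proof.
move=> imn; rewrite (bigD1_seq i) ?iota_uniq ?mem_index_iota //= eqxx.
by rewrite big1 // => j /negPf ->.
Qed.

(* Adjacency of i_2 and j_1 for 3 <= i, j <= k, which is a tournament. *)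
Definition Hpp_tour (k i j : nat) : bool :=
  [&& i != j & 0 < 2 * ((j + (k - 2) - i) %% (k - 2)) < k - 2]
  || (2 * j == 2 * i + (k - 2)).

Lemma modn_cyclic_diff n a b : a < n -> b < n ->
  (a + n - b) %% n = if b <= a then a - b else a + n - b.
Proof.
move=> an bn; case: leqP => ab; last by rewrite modn_small; lia.
by rewrite addnC -addnBA // modnDl modn_small //; lia.
Qed.

(** For distinct indices the two cyclic distances add up to k - 2, so at most one is below half; at
    exactly half, the arc goes from the smaller index to the larger. The case i = j gives
    irreflexivity. *)
Lemma Hpp_tour_antisym k i j : 3 <= i <= k -> 3 <= j <= k ->
  ~~ (Hpp_tour k i j && Hpp_tour k j i).
Proof.
have diff a b : 3 <= a <= k -> 3 <= b <= k -> (b + (k - 2) - a) %% (k - 2) =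
    if a <= b then b - a else b + (k - 2) - a.
  (* Shifted by 3, the indices become residues below k - 2. *)
  move=> a3 b3; have -> : b + (k - 2) - a = b - 3 + (k - 2) - (a - 3) by lia.
  by rewrite modn_cyclic_diff; [do 2 case: leqP => ? | |]; lia.
move=> ik jk; rewrite /Hpp_tour !diff //.
by case: (ltngtP i j) => ij; lia.
Qed.

Lemma eq12F a : 3 <= a -> ((a == 1) = false) * ((a == 2) = false)
  * ((1 == a) = false) * ((2 == a) = false).
Proof. by case: a => [|[|[|a]]]. Qed.

Lemma Hpp_adjE k i j : 3 <= i -> 3 <= j ->
  [/\ [/\ Hpp_adj k i 0 j 0 = false, Hpp_adj k i 0 j 1 = (j == i)
        & Hpp_adj k i 0 j 2 = (j == i)],
      [/\ Hpp_adj k i 1 j 0 = (j == i), Hpp_adj k i 1 j 1 = false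
        & Hpp_adj k i 1 j 2 = Hpp_tour k j i]
    & [/\ Hpp_adj k i 2 j 0 = (j == i), Hpp_adj k i 2 j 1 = Hpp_tour k i j
        & Hpp_adj k i 2 j 2 = false]].
Proof.
move=> i3 j3; rewrite /Hpp_adj /Hpp_arc i3 j3.
rewrite !(eq12F i3) !(eq12F j3) /= !(andbT, andbF, orbF) /Hpp_tour [i == j]eq_sym.
by do 2 split.
Qed.

Lemma Hpp_adj_hubs k i : 3 <= i ->
  [/\ Hpp_adj k i 0 1 1 + Hpp_adj k i 0 2 2 = 0,
      Hpp_adj k i 1 1 1 + Hpp_adj k i 1 2 2 = 1
    & Hpp_adj k i 2 1 1 + Hpp_adj k i 2 2 2 = 1].
Proof.
by move=> i3; rewrite /Hpp_adj /Hpp_arc i3 !(eq12F i3).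
Qed.

Lemma Hpp_degree_hubs k : 2 <= k ->
  Hpp_degree k 1 1 = k - 1 /\ Hpp_degree k 2 2 = k - 1.
Proof.
move=> k2; rewrite /Hpp_degree.
by split; (rewrite (eq_big_nat _ _ (F2 := fun=> 1)) ?sum_nat_const_nat;
  [rewrite /Hpp_adj /Hpp_arc /=; lia
  |move=> j /andP[j3 _]; rewrite /Hpp_adj /Hpp_arc j3 !(eq12F j3)]).
Qed.

Lemma Hpp_degree_triple k i : 3 <= i < k.+1 ->
  [/\ Hpp_degree k i 0 = 2,
      Hpp_degree k i 1 = 2 + \sum_(3 <= j < k.+1) (Hpp_tour k j i : nat)
    & Hpp_degree k i 2 = 2 + \sum_(3 <= j < k.+1) (Hpp_tour k i j : nat)].
Proof.
move=> ik; have /andP[i3 _] := ik; have [h0 h1 h2] := Hpp_adj_hubs k i3.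
rewrite /Hpp_degree h0 h1 h2; split.
- rewrite (eq_big_nat _ _ (F2 := fun j => (j == i) + (j == i))).
    by rewrite big_split /= sum_nat_eq_index.
  by move=> j /andP[j3 _]; have [[-> -> ->] _ _] := Hpp_adjE k i3 j3.
- rewrite (eq_big_nat _ _ (F2 := fun j => (j == i) + Hpp_tour k j i)).
    by rewrite big_split /= sum_nat_eq_index // addnA.
  by move=> j /andP[j3 _]; have [_ [-> -> ->] _] := Hpp_adjE k i3 j3; rewrite addn0.
- rewrite (eq_big_nat _ _ (F2 := fun j => (j == i) + Hpp_tour k i j)).
    by rewrite big_split /= sum_nat_eq_index // addnA.
  by move=> j /andP[j3 _]; have [_ _ [-> -> ->]] := Hpp_adjE k i3 j3; rewrite addn0.
Qed.

(** Each of the k - 3 indices other than [i] is met in at most one direction, and [i] itself in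
    none. *)
Lemma sum_Hpp_tour k i : 3 <= i < k.+1 ->
  \sum_(3 <= j < k.+1) (Hpp_tour k j i : nat)
  + \sum_(3 <= j < k.+1) (Hpp_tour k i j : nat) <= k - 3.
Proof.
move=> ik; rewrite -big_split /= (bigD1_seq i) ?iota_uniq ?mem_index_iota //=.
have := Hpp_tour_antisym ik ik; rewrite andbb => /negPf -> /=.
rewrite add0n -(leq_add2l 1).
apply: (@leq_trans (\sum_(3 <= j < k.+1) 1)); last first.
  by rewrite sum_nat_const_nat; lia.
rewrite [leqRHS](bigD1_seq i) ?iota_uniq ?mem_index_iota //= leq_add2l.
rewrite big_seq_cond [leqRHS]big_seq_cond; apply: leq_sum => j.
rewrite mem_index_iota => /andP[jk _].
by have := Hpp_tour_antisym ik jk; do 2 case: Hpp_tour.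
Qed.

(** Each hub has degree k - 1 >= 4 and costs 1 + (k - 3). The degrees in a triple are 2, 2 + t and 2
    + s with s + t <= k - 3, and 2 + t has excess at most t, so a triple costs at most 3 + s + t <=
    k. The total is 2(k - 2) + (k - 2)k = k^2 - 4. *)
Lemma Hpp_size k : 5 <= k ->
  #|Hpp k| + \sum_(v : Hpp k) excess (degree v) <= k ^ 2 - 4.
Proof.
move=> k5; have k2 : 2 <= k by lia.
rewrite -sum1_card -big_split /=.
under eq_bigr do rewrite Hpp_degreeE //.
rewrite (sum_Hpp (fun i a => 1 + excess (Hpp_degree k i a))) //.
have [-> ->] := Hpp_degree_hubs k2.
have triples : \sum_(3 <= j < k.+1) (1 + excess (Hpp_degree k j 0)
    + (1 + excess (Hpp_degree k j 1)) + (1 + excess (Hpp_degree k j 2)))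
    <= \sum_(3 <= j < k.+1) k.
  rewrite big_nat [leqRHS]big_nat; apply: leq_sum => j jk.
  have [-> -> ->] := Hpp_degree_triple jk; have := sum_Hpp_tour jk.
  set s := \sum_(_ <= i < _) (Hpp_tour k i j : nat).
  set t := \sum_(_ <= i < _) (Hpp_tour k j i : nat).
  by rewrite /excess /=; case: ifP => ?; case: ifP => ?; lia.
apply: leq_trans (leq_add (leqnn _) triples) _; rewrite sum_nat_const_nat.
by rewrite /excess ifF; nia.
Qed.

Theorem theorem28 (R : realType) (k : nat) (hk : 5 <= k) :
  exists G : sgraph,
    [/\ #|G| = k ^ 2 - 4,
        forall v : G, degree v <= 3
      & LS_rank R G >= LS_rank R (Hpp k)].
Proof.
have [H [dH cH rH]] := cubic_stretching R (Hpp k).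
have sz := Hpp_size hk.
have nonempty : 0 < #|Hpp k|.
  by rewrite -sum1_card (sum_Hpp (fun _ _ => 1)) //; lia.
exists (pad H (k ^ 2 - 4 - #|H|)); split.
- by rewrite card_pad; lia.
- exact: pad_degree.
- apply: leq_trans rH (LS_rank_pad _ _ _); lia.
Qed.
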